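(* For every dynamic uncompressed quadtree $T_1$ over $\mathbb{R}^d$, subject to split and merge operations, one can maintain its extended quadtree $T^*$ (with $T_1\subseteq T^*$) using at most $\mathcal{O}((2d)^d)$ operations per split or merge on $T_1$.
   Context: A quadtree on an axis-aligned root hypercube $R\subset\mathbb{R}^d$ is a hierarchical decomposition in which every node has an associated axis-aligned hypercube (cell) and is either a leaf or has $2^d$ equal-sized children whose cells subdivide its cell. The size $|C|$ of a cell is its edge length. The split operation on a leaf $C$ inserts the $2^d$ equal-sized children of $C$; the merge operation on $2^d$ leaves with a common parent removes these $2^d$ cells. Two cells are neighbors if they are interior-disjoint and share (part of) a $(d-1)$-dimensional facet. For an integer $j$, a cell $C$ is $2^j$-smooth if every leaf neighboring $C$ has size at most $2^j|C|$. Extended quadtree: the cells of $T_1$ get brand $1$. Recursively, for $j\ge1$, let $T^j$ be the quadtree formed by $\bigcup_{i\le j}T_i$, and let $T_{j+1}$ be the minimal set of cells obtained by splitting cells of $T^j$ such that every cell of $T_j$ is $2^j$-smooth in the resulting quadtree; the cells of $T_{j+1}$ get brand $j+1$. The extended quadtree is $T^*=T^{d+1}$. Operations counted are split/merge operations (and brand updates) performed on $T^*$. *)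

(* Defs.v *)
From mathcomp Require Import all_boot.
Set Implicit Arguments. Unset Strict Implicit. Unset Printing Implicit Defensive.

(* Root hypercube R = [0,1]^d.  A cell is given by its depth k (edge length
   2^-k) and its integer index a : 'I_d -> nat; it is the box
   prod_i [a_i 2^-k, (a_i + 1) 2^-k]. *)
Definition cell (d : nat) := (nat * {ffun 'I_d -> nat})%type.

Definition depth d (c : cell d) : nat := c.1.
Definition idx d (c : cell d) (i : 'I_d) : nat := c.2 i.

Definition root_cell (d : nat) : cell d := (0, [ffun _ => 0]).

Definition is_child d (p c : cell d) : Prop :=
  depth c = (depth p).+1 /\ forall i, (idx c i)./2 = idx p i.

Definition parent d (c : cell d) : cell d :=
  ((depth c).-1, [ffun i => (idx c i)./2]).

Definition cset d := cell d -> Prop.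

(* A quadtree on the root cube: a finite set of cells, containing the root,
   all cells inside the root, and every non-root cell comes with its parent
   and all 2^d siblings (every node is a leaf or has all 2^d children). *)
Definition quadtree d (Q : cset d) : Prop :=
  [/\ exists s : seq (cell d), forall c, Q c -> c \in s,
      forall c, Q c -> forall i, idx c i < 2 ^ depth c,
      Q (root_cell d)
    & forall c, Q c -> 0 < depth c ->
        Q (parent c) /\ forall c', is_child (parent c) c' -> Q c'].

Definition leaf d (Q : cset d) (c : cell d) : Prop :=
  Q c /\ forall c', is_child c c' -> ~ Q c'.

(* Coordinates of the box of c in direction i, rescaled to the grid of
   depth m >= depth c (integers). *)
Definition lo d (m : nat) (c : cell d) (i : 'I_d) : nat :=
  idx c i * 2 ^ (m - depth c).
Definition hi d (m : nat) (c : cell d) (i : 'I_d) : nat :=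
  (idx c i).+1 * 2 ^ (m - depth c).

(* Neighbors: interior-disjoint and sharing a (d-1)-dimensional part of a
   facet: they touch in one direction j and their open projections overlap
   in every other direction. *)
Definition neighbor d (c c' : cell d) : Prop :=
  let m := maxn (depth c) (depth c') in
  exists j : 'I_d,
    (hi m c j = lo m c' j \/ hi m c' j = lo m c j) /\
    forall i, i != j -> lo m c i < hi m c' i /\ lo m c' i < hi m c i.

(* c is 2^j-smooth in Q: every leaf neighbor L of c has |L| <= 2^j |c|,
   i.e. 2^-(depth L) <= 2^j 2^-(depth c). *)
Definition smooth d (Q : cset d) (c : cell d) (j : nat) : Prop :=
  forall L, leaf Q L -> neighbor c L -> depth c <= depth L + j.

Definition least d (P : cset d -> Prop) : cset d :=
  fun c => forall S, P S -> S c.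

(* ext T1 n = (T^(n+1), T_(n+1)). *)
Fixpoint ext d (T1 : cset d) (n : nat) : cset d * cset d :=
  match n with
  | 0 => (T1, T1)
  | n'.+1 =>
      let A := (ext T1 n').1 in
      let B := (ext T1 n').2 in
      let A' := least (fun S => [/\ quadtree S, (forall c, A c -> S c)
                               & forall c, B c -> smooth S c n'.+1]) in
      (A', fun c => A' c /\ ~ A c)
  end.

Definition extended d (T1 : cset d) : cset d := (ext T1 d).1.

(* A maintained state: the cell set of T* together with the brands. *)
Definition state d := (cset d * (cell d -> nat))%type.

Definition is_ext d (T1 : cset d) (st : state d) : Prop :=
  (forall c, st.1 c <-> extended T1 c) /\
  (forall n c, n <= d -> (ext T1 n).2 c -> st.2 c = n.+1).

Definition split_op d (Q Q' : cset d) : Prop :=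
  exists c, leaf Q c /\ forall x, Q' x <-> Q x \/ is_child c x.
Definition merge_op d (Q Q' : cset d) : Prop :=
  exists c, [/\ Q c, (forall x, is_child c x -> leaf Q x)
              & forall x, Q' x <-> Q x /\ ~ is_child c x].

(* One elementary operation on T*: a split (which also sets the brands of the
   new children), a merge, or the update of the brand of one cell. *)
Definition step d (st st' : state d) : Prop :=
  [\/ split_op st.1 st'.1 /\ (forall x, st.1 x -> st'.2 x = st.2 x),
      merge_op st.1 st'.1 /\ (forall x, st'.1 x -> st'.2 x = st.2 x)
    | (forall x, st'.1 x <-> st.1 x) /\
      exists c, st.1 c /\ forall x, x <> c -> st.1 x -> st'.2 x = st.2 x].

Fixpoint reach_within d (n : nat) (st st' : state d) : Prop :=
  match n with
  | 0 => st = st'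
  | n'.+1 => st = st' \/ exists st'', step st st'' /\ reach_within n' st'' st'
  end.

(* Main.v *)
(* A quadtree is determined by its set of internal cells.  If [I_n] is that set
   for T^n, then making the children of q in [I_n] 2^n-smooth forces exactly the
   n-fold ancestors of the equal-sized neighbors of q to become internal, and
   these ancestors again form a parent-closed set, so I_(n+1) is [I_n] together
   with all of them.  Hence inserting one internal cell c into T_1 changes the
   presence or the brand only of the cells reached from c in d rounds of "stay,
   or move to a neighbor and then to its n-fold ancestor".  Of the two moves per
   axis, one stays inside the parent and reaches a cell that is present already,
   so at most (d+1)^d families of 2^d siblings are touched, and
   2^d (d+1)^d <= 8 (2d)^d.  The parent of a newly internal cell was internal
   before, so the families can be updated in any order, for splits as for
   merges. *)

Require Import Defs.
From mathcomp Require Import all_boot.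
From mathcomp Require Import boolp zify.
Set Implicit Arguments. Unset Strict Implicit. Unset Printing Implicit Defensive.

(** * Arithmetic of powers and integer division *)

(** Inductively [(1 + 1/d)^k * (1 - k/d) <= 1]. Taking [k = d./2] bounds half of the power by a
    factor 2; squaring gives 4, and a leftover odd factor at most 2 more. *)
Lemma expS_le_expn d : 0 < d -> d.+1 ^ d <= 8 * d ^ d.
Proof.
move=> d0.
have growth k : k <= d -> d.+1 ^ k * (d - k) <= d ^ k.+1.
  elim: k => [|k IH] kd; first by rewrite expn0 mul1n subn0 expn1.
  have step : d.+1 * (d - k.+1) <= d * (d - k) by nia.
  rewrite expnS (expnS d) mulnAC.
  apply: leq_trans (leq_mul step (leqnn _)) _.
  by rewrite -mulnA leq_mul2l mulnC IH ?orbT // ltnW.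
have half : d.+1 ^ d./2 <= 2 * d ^ d./2.
  have hd : d./2 <= d by lia.
  have := growth _ hd; rewrite expnS => h.
  by rewrite -(leq_pmul2r d0); nia.
have split_exp x : x ^ d = x ^ odd d * (x ^ d./2 * x ^ d./2).
  by rewrite -!expnD addnn odd_double_half.
rewrite !split_exp.
have odd_le : d.+1 ^ odd d <= 2 * d ^ odd d by case: (odd d); rewrite ?expn1 ?expn0; lia.
apply: leq_trans (leq_mul odd_le (leq_mul half half)) _.
lia.
Qed.

Lemma divn_eqE m n k : 0 < n -> (m %/ n == k) = (k * n <= m < k.+1 * n).
Proof. by move=> n0; rewrite eqn_leq -ltnS ltn_divLR // leq_divRL // andbC. Qed.

(** * Cells, ancestors and children *)

Section Cells.
Variable d : nat.
Implicit Types (c p q r x : cell d) (I J : pred (cell d)).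

Definition inroot c := [forall i, idx c i < 2 ^ depth c].
Definition anc n c := iter n (@parent d) c.

Lemma cell_eq c c' : depth c = depth c' -> (forall i, idx c i = idx c' i) -> c = c'.
Proof.
case: c c' => [k a] [k' a']; rewrite /depth /idx /= => -> e.
by congr pair; apply/ffunP.
Qed.

Lemma depth_parent c : depth (parent c) = (depth c).-1. Proof. by []. Qed.

Lemma idx_parent c i : idx (parent c) i = (idx c i)./2.
Proof. by rewrite /idx ffunE. Qed.

Lemma depth_anc n c : depth (anc n c) = depth c - n.
Proof. by elim: n => [|n IH]; rewrite ?subn0 // /anc iterS depth_parent IH subnS. Qed.

Lemma idx_anc n c i : idx (anc n c) i = idx c i %/ 2 ^ n.
Proof.
elim: n => [|n IH]; first by rewrite expn0 divn1.
by rewrite /anc iterS idx_parent IH -divn2 -divnMA expnSr.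
Qed.

Lemma anc_add m n c : anc (m + n) c = anc m (anc n c).
Proof. exact: iterD. Qed.

Lemma anc_parent n c : anc n (parent c) = anc n.+1 c.
Proof. by rewrite /anc iterSr. Qed.

Lemma parent_anc n c : parent (anc n c) = anc n.+1 c.
Proof. by []. Qed.

Lemma inroot_root : inroot (root_cell d).
Proof. by apply/forallP => i; rewrite /idx ffunE. Qed.

Lemma inroot_depth0 c : inroot c -> depth c = 0 -> c = root_cell d.
Proof.
move=> /forallP h c0; apply: cell_eq => // i; rewrite [RHS]/idx ffunE.
by have := h i; rewrite c0 expn0; case: (idx c i).
Qed.

Lemma inroot_parent c : inroot c -> inroot (parent c).
Proof.
move=> /forallP h; apply/forallP => i; rewrite idx_parent depth_parent.
have := h i; case: (depth c) => [|k] /=; first by rewrite expn0; lia.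
by rewrite expnS; lia.
Qed.

Lemma inroot_anc n c : inroot c -> inroot (anc n c).
Proof. by elim: n => [//|n IH] /IH; apply: inroot_parent. Qed.

Lemma anc_root n c : inroot c -> depth c <= n -> anc n c = root_cell d.
Proof.
by move=> hc cn; apply: inroot_depth0; [exact: inroot_anc | rewrite depth_anc; lia].
Qed.

Lemma inroot_child c : 0 < depth c -> inroot (parent c) -> inroot c.
Proof.
move=> c0 /forallP h; apply/forallP => i; have := h i.
by rewrite idx_parent depth_parent; case: (depth c) c0 => [//|k] _ /=; rewrite expnS; lia.
Qed.

Lemma is_childE p c : is_child p c <-> 0 < depth c /\ parent c = p.
Proof.
split=> [[dc ic]|[c0 <-]].
  split; first by rewrite dc.
  by apply: cell_eq => [|i]; rewrite ?depth_parent ?dc // idx_parent.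
by split=> [|i]; rewrite ?depth_parent ?prednK ?idx_parent.
Qed.

Definition child p (b : {ffun 'I_d -> bool}) : cell d :=
  ((depth p).+1, [ffun i => b i + (idx p i).*2]).

Lemma child_is_child p b : is_child p (child p b).
Proof. by split=> // i; rewrite /idx ffunE half_bit_double. Qed.

Definition children p := [seq child p b | b : {ffun 'I_d -> bool}].

Lemma size_children p : size (children p) = 2 ^ d.
Proof. by rewrite size_map -cardE card_ffun card_bool card_ord. Qed.

Lemma mem_children p c : reflect (is_child p c) (c \in children p).
Proof.
apply: (iffP mapP) => [[b _ ->]|[dc ic]]; first exact: child_is_child.
exists [ffun i => odd (idx c i)]; first by rewrite mem_enum.
apply: cell_eq => // i.
by rewrite [RHS]/idx !ffunE -ic odd_double_half.
Qed.

Lemma children_depthP p c : c \in children p -> 0 < depth c /\ parent c = p.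
Proof. by move/mem_children/is_childE. Qed.

(** * Quadtrees as parent-closed sets of internal cells *)

(* A quadtree is recorded by the set [I] of its internal cells. *)
Definition tree I : pred (cell d) :=
  fun x => (x == root_cell d) || (0 < depth x) && I (parent x).

(** [parent] fixes the root cell, so closure under [parent] is stated at every depth; the depth
    bound encodes finiteness. *)
Definition good I :=
  [/\ forall p, I p -> inroot p, forall p, I p -> I (parent p)
    & exists K, forall p, I p -> depth p <= K].

Lemma good_anc I n p : good I -> I p -> I (anc n p).
Proof. by case=> _ h _; elim: n p => [//|n IH] p /IH; apply: h. Qed.

Lemma good_root I p : good I -> I p -> I (root_cell d).
Proof.
move=> gI Ip; have [ir _ _] := gI.
by rewrite -(anc_root (ir _ Ip) (leqnn _)); apply: good_anc.
Qed.

Lemma tree_inroot I x : good I -> tree I x -> inroot x.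
Proof.
case=> ir _ _ /orP[/eqP->|/andP[x0 /ir]]; first exact: inroot_root.
exact: inroot_child.
Qed.

Lemma tree_internal I p : good I -> I p -> tree I p.
Proof.
case=> ir cl _ Ip; have [p0|p0] := posnP (depth p).
  by rewrite (inroot_depth0 (ir _ Ip) p0) /tree eqxx.
by rewrite /tree p0 cl ?orbT.
Qed.

Lemma tree_child I p x : is_child p x -> tree I x = I p.
Proof.
move=> /is_childE[x0 <-]; rewrite /tree x0 /=.
by have [e|//] := eqVneq x (root_cell d); rewrite e in x0.
Qed.

Lemma tree_sub I J : (forall p, I p -> J p) -> forall x, tree I x -> tree J x.
Proof.
by move=> sIJ x /orP[/eqP->|/andP[x0 /sIJ h]]; rewrite /tree ?eqxx // x0 h orbT.
Qed.

(** Membership of a child in the tree is decided by its parent alone, and every cell has a child to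
    test. *)
Lemma internal_sub I J : (forall x, tree I x -> tree J x) -> forall p, I p -> J p.
Proof.
move=> s p; have cp := child_is_child p [ffun => false].
by rewrite -(tree_child I cp) => /s; rewrite (tree_child J cp).
Qed.

Lemma leaf_tree I x : leaf (tree I) x <-> tree I x /\ ~~ I x.
Proof.
split=> -[tx h]; split=> //.
  have cx := child_is_child x [ffun => false].
  by apply/negP; rewrite -(tree_child I cx); apply: h.
by move=> y cy; rewrite (tree_child I cy); apply/negP.
Qed.

Lemma inroot_finite K :
  exists s : seq (cell d), forall c, inroot c -> depth c <= K -> c \in s.
Proof.
exists [seq (k, [ffun i => val ((f : {ffun 'I_d -> 'I_(2 ^ K).+1}) i)])
          | k <- iota 0 K.+1, f <- enum {ffun 'I_d -> 'I_(2 ^ K).+1}].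
move=> c /forallP ic cK; apply/allpairsP.
exists (depth c, [ffun i => inord (idx c i)]); split; rewrite ?mem_enum ?mem_iota //.
apply: cell_eq => // i; rewrite [RHS]/idx /= !ffunE inordK //.
have := leq_pexp2l (isT : 0 < 2) cK; have := ic i; lia.
Qed.

Lemma quadtree_tree I : good I -> quadtree (tree I).
Proof.
move=> gI; have [ir cl [K bK]] := gI; split.
- have [s sP] := inroot_finite K.+1; exists s => c tc; apply: sP.
    exact: tree_inroot tc.
  by case/orP: tc => [/eqP->//|/andP[_ /bK]]; rewrite depth_parent; lia.
- by move=> c /(tree_inroot gI)/forallP.
- by rewrite /tree eqxx.
move=> c /orP[/eqP->//|/andP[c0 Ip]] _; split; first exact: tree_internal.
by move=> c' cc'; rewrite (tree_child I cc').
Qed.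

Lemma quadtreeP (Q : cset d) :
  quadtree Q -> exists2 I, good I & Q = (fun x => tree I x).
Proof.
case=> [[s sP] ir rt cl].
have irQ c : Q c -> inroot c by move=> h; apply/forallP; apply: ir.
pose I p := `[< exists x, Q x /\ is_child p x >].
have IP p : I p -> exists x, [/\ Q x, 0 < depth x & parent x = p].
  by move=> /asboolP[x [Qx /is_childE[x0 xp]]]; exists x.
have I_parent x : Q x -> 0 < depth x -> I (parent x).
  by move=> Qx x0; apply/asboolP; exists x; split=> //; apply/is_childE.
exists I.
  split.
  - by move=> p /IP[x [Qx x0 <-]]; apply/inroot_parent/irQ.
  - move=> p Ip; have [x [Qx x0 xp]] := IP _ Ip.
    have Qp : Q p by rewrite -xp; have [] := cl x Qx x0.
    have [p0|p0] := posnP (depth p); last exact: I_parent.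
    have p_root := inroot_depth0 (irQ _ Qp) p0.
    suff -> : parent p = p by [].
    by rewrite {2}p_root; apply: (@anc_root 1); rewrite ?p0 //; apply: irQ.
  exists (\max_(c <- s) depth c) => p /IP[x [/sP xs _ <-]].
  exact: leq_trans (leq_pred _) (leq_bigmax_seq (F := @depth d) _ xs isT).
apply/predeqP => x; split=> [Qx|/orP[/eqP->//|/andP[x0 /IP[y [Qy y0 yx]]]]].
  have [x0|x0] := posnP (depth x); last by rewrite /tree x0 I_parent ?orbT.
  by rewrite (inroot_depth0 (irQ _ Qx) x0) /tree eqxx.
by have [_] := cl y Qy y0; rewrite yx; apply; apply/is_childE.
Qed.

(** * Equal-sized neighbors and one smoothing round *)

Definition adjacent q r :=
  depth r = depth q /\
  exists i, (idx r i = (idx q i).+1 \/ idx q i = (idx r i).+1) /\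
    forall j, j != i -> idx r j = idx q j.

Lemma adjacent_parent q r :
  adjacent q r -> parent r = parent q \/ adjacent (parent q) (parent r).
Proof.
case=> dr [i [ri rj]].
have dp : depth (parent r) = depth (parent q) by rewrite !depth_parent dr.
have pj j : j != i -> idx (parent r) j = idx (parent q) j.
  by move=> /rj e; rewrite !idx_parent e.
have [e|ne] := eqVneq (idx (parent r) i) (idx (parent q) i); [left|right].
  by apply: cell_eq => // j; have [->//|/pj] := eqVneq j i.
split=> //; exists i; split=> //.
by move: ne; rewrite !idx_parent; lia.
Qed.

(** One smoothing round with parameter [n], in closed form; [inroot r] discards neighbors beyond the
    boundary of the root cube. *)
Definition grow n I : pred (cell d) := fun p => I p ||
  `[< exists q r, [/\ I q, adjacent q r, inroot r & p = anc n r] >].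

Lemma growP n I p : reflect
  (I p \/ exists q r, [/\ I q, adjacent q r, inroot r & p = anc n r])
  (grow n I p).
Proof.
by apply: (iffP orP) => -[h|h]; [left|right; apply/asboolP|left|right; apply/asboolP].
Qed.

(** Taking parents commutes with [anc n], and the parents of two adjacent cells coincide or are
    again adjacent. *)
Lemma good_grow n I : good I -> good (grow n I).
Proof.
move=> gI; have [ir cl [K bK]] := gI; split.
- by move=> p /growP[/ir//|[q [r [_ _ hr ->]]]]; apply: inroot_anc.
- move=> p /growP[Ip|[q [r [Iq qr hr ->]]]]; apply/growP; first by left; apply: cl.
  have [e|a] := adjacent_parent qr.
    by left; rewrite parent_anc -anc_parent e; apply/good_anc/cl.
  right; exists (parent q), (parent r); split=> //; first exact: cl.
    exact: inroot_parent.
  by rewrite anc_parent.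
exists K => p /growP[/bK//|[q [r [/bK qK [dr _] _ ->]]]].
by rewrite depth_anc; lia.
Qed.

(* A leaf [L] meeting a facet of [c] from outside lies above the cell adjacent
   to the parent of [c] across that facet. *)
Lemma smooth_grow I c j : good I -> tree I c -> smooth (tree (grow j I)) c j.
Proof.
move=> gI tc L /leaf_tree[tL nL] [i]; rewrite leqNgt.
have gG := good_grow j gI.
have irL := tree_inroot gG tL.
move=> nb; apply/negP => dcL.
have c0 : 0 < depth c by lia.
have Iq : I (parent c).
  by case/orP: tc => [/eqP e|/andP[]//]; rewrite e in c0.
pose q := parent c; pose t := depth q - depth L.
have dq : depth c = (depth q).+1 by rewrite depth_parent prednK.
have qt : depth q = depth L + t by rewrite subnKC //; lia.
have tj : j <= t by lia.
(* It suffices to present [L] as such an ancestor: as [j <= t], it equals or lies above [anc j r],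
   which is internal after the round, so [L] cannot be a leaf. *)
suff [r [qr hr Lr]] : exists r, [/\ adjacent q r, inroot r & L = anc t r].
  move/negP: nL; apply; rewrite Lr -(subnK tj) anc_add.
  by apply: good_anc => //; apply/growP; right; exists q, r.
have qc (x : 'I_d) : idx q x = (idx c x)./2 by rewrite idx_parent.
have qir : inroot q by case: gI => ir _ _; apply: ir.
case: nb; rewrite /lo /hi.
rewrite (maxn_idPl _); last by lia.
rewrite subnn expn0 !muln1.
have -> : depth c - depth L = t.+1 by lia.
rewrite expnSr => hi_lo other.
have pos : 0 < 2 ^ t by rewrite expn_gt0.
have Lj (x : 'I_d) : x != i -> idx L x = idx q x %/ 2 ^ t.
  move=> /other[]; rewrite !muln1 qc => h1 h2; apply/esym/eqP.
  by rewrite divn_eqE //; nia.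
pose r v : cell d := (depth q, [ffun x => if x == i then v else idx q x]).
have rE v (x : 'I_d) : idx (r v) x = if x == i then v else idx q x by rewrite /idx ffunE.
suff [v [qv vi vL]] : exists v, [/\ v = (idx q i).+1 \/ idx q i = v.+1,
    v < 2 ^ depth q & idx L i = v %/ 2 ^ t].
  exists (r v); split.
  - split=> //; exists i; rewrite rE eqxx; split=> // x /negPf xi.
    by rewrite rE xi.
  - by apply/forallP => x; rewrite rE; case: eqP => // _; move/forallP: qir; apply.
  apply: cell_eq => [|x]; first by rewrite depth_anc -[depth (r v)]/(depth q) qt addnK.
  by rewrite idx_anc rE; case: eqP => [->|/eqP/Lj].
move/forallP/(_ i): irL; move/forallP/(_ i): qir.
rewrite qt expnD qc => qi Li.
(* The shared coordinate is a multiple of [2 * 2 ^ t], hence also a side of the parent [q]; [v] is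
   the index just beyond that side. *)
case: hi_lo => e; [exists (idx c i)./2.+1 | exists (idx c i)./2.-1].
  split; [by left| nia |].
  by apply/esym/eqP; rewrite divn_eqE //; nia.
split; [right; nia|nia|].
by apply/esym/eqP; rewrite divn_eqE //; nia.
Qed.

(* The lowest leaf above [r] is too large to be a neighbor of a child of [q],
   unless it already lies below [anc j r]. *)
Lemma smooth_anc J q r j : good J -> J q -> adjacent q r -> inroot r ->
  (forall c, is_child q c -> smooth (tree J) c j) -> J (anc j r).
Proof.
move=> gJ Jq [dr [i [ri rk]]] hr sm.
have exJ : exists n, J (anc n r).
  by exists (depth q); rewrite anc_root // ?dr //; apply: good_root Jq.
case: (ex_minnP exJ) => n Jn n_min.
have [nj|jn] := leqP n j.
  by rewrite -(subnK nj) anc_add; apply: good_anc.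
have nq : n <= depth q.
  by apply: n_min; rewrite anc_root // ?dr //; apply: good_root Jq.
(* Since [n > j], write [n = t.+1]: [anc t r] has an internal parent but is not internal itself, so
   it is a leaf. *)
case: n => [//|t] in Jn n_min jn nq *.
have nJ : ~~ J (anc t r) by apply/negP => /n_min; rewrite ltnn.
have dL : depth (anc t r) = depth q - t by rewrite depth_anc dr.
have lL : leaf (tree J) (anc t r).
  by apply/leaf_tree; split=> //; rewrite /tree parent_anc Jn andbT dL; lia.
(* Equal indices along [i] would make the [t]-fold ancestors of [q] and [r] the same cell, yet the
   one of [q] is internal. *)
have ne : idx r i %/ 2 ^ t != idx q i %/ 2 ^ t.
  apply: contraNneq nJ => e; suff -> : anc t r = anc t q by apply: good_anc.
  apply: cell_eq => [|k]; first by rewrite dL depth_anc.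
  by rewrite !idx_anc; have [->//|/rk->] := eqVneq k i.
suff [c qc /(sm c qc _ lL)] : exists2 c, is_child q c & neighbor c (anc t r).
  by case: qc => -> _; rewrite dL; lia.
have pos : 0 < 2 ^ t by rewrite expn_gt0.
(* Along [i] this picks the child of [q] facing [r]; in the other directions either choice overlaps
   [anc t r]. *)
pose b := [ffun _ : 'I_d => idx q i < idx r i].
exists (child q b); first exact: child_is_child.
have dc : depth (child q b) = (depth q).+1 by [].
have ic (k : 'I_d) : idx (child q b) k = (idx q i < idx r i) + (idx q k).*2.
  by rewrite /idx !ffunE.
exists i; rewrite /lo /hi (maxn_idPl _) ?dc ?dL; last by lia.
have -> : (depth q).+1 - (depth q - t) = t.+1 by lia.
rewrite subnn expn0 !muln1 expnSr; split.
  rewrite ic idx_anc.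
  have /andP[h1 h2] : idx r i %/ 2 ^ t * 2 ^ t <= idx r i < (idx r i %/ 2 ^ t).+1 * 2 ^ t.
    by rewrite -divn_eqE.
  have /andP[h3 h4] : idx q i %/ 2 ^ t * 2 ^ t <= idx q i < (idx q i %/ 2 ^ t).+1 * 2 ^ t.
    by rewrite -divn_eqE.
  have mono m n : m <= n -> m * 2 ^ t <= n * 2 ^ t by rewrite leq_mul2r orbC => ->.
  case: (ltngtP (idx q i %/ 2 ^ t) (idx r i %/ 2 ^ t)) ne => [/mono lt|/mono lt|//] _.
    by case: ri => e; [left|]; lia.
  by case: ri => e; [|right]; lia.
move=> k /rk e; rewrite ic idx_anc e muln1.
have /andP[h3 h4] : idx q k %/ 2 ^ t * 2 ^ t <= idx q k < (idx q k %/ 2 ^ t).+1 * 2 ^ t.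
  by rewrite -divn_eqE.
by case: (idx q i < idx r i); nia.
Qed.

(** * Closed form of the extended quadtree *)

(* Internal cells of the quadtree T^(n+1) obtained from the quadtree T_1 with
   internal cells [I]. *)
Fixpoint upto I n : pred (cell d) :=
  if n is m.+1 then grow m.+1 (upto I m) else I.

Lemma good_upto I n : good I -> good (upto I n).
Proof. by move=> gI; elim: n => [//|n IH]; apply: good_grow. Qed.

Lemma upto_mono I m n p : m <= n -> upto I m p -> upto I n p.
Proof.
move=> /subnK <-; elim: (n - m) => [//|k IH] /IH h.
by apply/growP; left.
Qed.

(** The grown tree is admissible by [smooth_grow], and [smooth_anc] places it inside every
    admissible quadtree, so it is the least one. *)
Lemma extE I n : good I ->
  (ext (fun x => tree I x) n).1 = (fun x => tree (upto I n) x : Prop) /\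
  forall x, (ext (fun x => tree I x) n).2 x <->
    tree (upto I n) x /\ (0 < n -> ~~ tree (upto I n.-1) x).
Proof.
move=> gI; elim: n => [|n [IH1 IH2]] /=; first by split=> // x; split=> [|[]].
have gn := good_upto n gI.
set A' := least _.
have -> : A' = (fun x => tree (grow n.+1 (upto I n)) x : Prop); last first.
  split=> // x; rewrite IH1.
  by split=> -[tx nx]; split=> //; [move=> _; apply/negP | apply/negP/nx].
apply/predeqP => x; split=> [Ax|tx S [qS sub sm]].
  apply: (Ax (fun y => tree (grow n.+1 (upto I n)) y)); split.
  - exact/quadtree_tree/good_grow.
  - by move=> c; rewrite IH1; apply: tree_sub => p Ip; apply/growP; left.
  by move=> c /IH2[tc _]; apply: smooth_grow.
have [J gJ eS] := quadtreeP qS; subst S.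
have sIJ : forall p, upto I n p -> J p.
  by apply: internal_sub => c tc; apply: sub; rewrite IH1.
apply: tree_sub tx => p /growP[/sIJ//|[q [r [Iq qr hr ->]]]].
(* Smoothness is demanded only for cells of the latest brand. If the children of [q] are older, the
   previous round already made [anc n r] internal, and [anc n.+1 r] is its parent. *)
case: (boolP ((0 < n) && upto I n.-1 q)) => [/andP[n0 Iq']|new].
  rewrite -[n.+1]add1n anc_add; apply: good_anc => //; apply: sIJ.
  by case: n {IH1 IH2 gn A' Iq sub sm} n0 Iq' => // m _ Iq'; apply/growP; right; exists q, r.
apply: (@smooth_anc _ q) => // [|c qc]; first exact: sIJ.
apply: sm; apply/IH2; rewrite !(tree_child _ qc); split=> // n0.
by rewrite n0 in new.
Qed.

(** * Cells affected by inserting one internal cell *)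

Section Insertion.
Variables (I J : pred (cell d)) (c0 : cell d).
Hypotheses (gI : good I) (gJ : good J) (JE : forall p, J p = (p == c0) || I p).
Hypothesis (tc0 : tree I c0).

Lemma upto_sub n p : upto I n p -> upto J n p.
Proof.
elim: n p => [|n IH] p /=; first by rewrite JE => ->; rewrite orbT.
move=> /growP[/IH|[q [r [/IH]]]] h; first by apply/growP; left.
by move=> *; apply/growP; right; exists q, r.
Qed.

(** For [c0] this is [tc0]. A round preserves it: the parents of adjacent cells coincide or are
    adjacent, so the same move can be made one level higher, starting from an old cell. *)
Lemma upto_parent n p : upto J n p -> 0 < depth p -> upto I n (parent p).
Proof.
elim: n p => [|n IH] p /=.
  rewrite JE => /orP[/eqP->|Ip _]; last by have [_ h _] := gI; apply: h.
  by case/orP: tc0 => [/eqP->//|/andP[]].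
move=> /growP[/IH h /h{}h|[q [r [Jq qr hr ->]]]]; first by apply/growP; left.
rewrite depth_anc qr.1 => qn; have q0 : 0 < depth q by lia.
have Iq := IH _ Jq q0; rewrite parent_anc -anc_parent.
have [->|a] := adjacent_parent qr.
  by apply/growP; left; apply: good_anc => //; apply: good_upto.
by apply/growP; right; exists (parent q), (parent r); split=> //; apply: inroot_parent.
Qed.

(* The neighbor of [q] across the facet orthogonal to direction [i] that [q]
   does not share with a sibling. *)
Definition outer q (i : 'I_d) : cell d :=
  (depth q, [ffun j => if j != i then idx q j
                       else if odd (idx q i) then (idx q i).+1 else (idx q i).-1]).

(** Of the two index shifts along an axis, the parity of the index decides which one changes the
    parent. *)
Lemma adjacent_outer q r :
  adjacent q r -> parent r = parent q \/ exists i, r = outer q i.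
Proof.
case=> dr [i [ri rj]].
have [e|ne] := eqVneq (idx (parent r) i) (idx (parent q) i); [left|right].
  apply: cell_eq => [|j]; first by rewrite !depth_parent dr.
  by have [->//|/rj] := eqVneq j i; rewrite !idx_parent => ->.
exists i; apply: cell_eq => // j; rewrite [RHS]/idx ffunE.
have [->|/rj//] /= := eqVneq j i.
by move: ne; rewrite !idx_parent; case: ifP; lia.
Qed.

(** An over-approximation of the cells newly internal after round [n]; keeping only outward moves
    gives [d + 1] instead of [2 * d + 1] choices per round. *)
Fixpoint reached n : seq (cell d) :=
  if n is m.+1 then
    reached m ++ [seq anc m.+1 (outer q i) | q <- reached m, i <- enum 'I_d]
  else [:: c0].

Lemma size_reached n : size (reached n) = d.+1 ^ n.
Proof.
elim: n => [//|n IH] /=.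
by rewrite size_cat size_allpairs size_enum_ord IH expnS mulSn mulnC.
Qed.

Lemma reached_mono m n p : m <= n -> p \in reached m -> p \in reached n.
Proof.
move=> /subnK <-; elim: (n - m) => [//|k IH] /IH h.
by rewrite /= mem_cat h.
Qed.

(** A cell added from an old [q] is old too, so [q] is new and listed by induction. An outward move
    is then listed as well, while a move to a sibling leads to an ancestor of the parent of [q],
    which is old by [upto_parent]. *)
Lemma upto_reached n p : upto J n p -> ~~ upto I n p -> p \in reached n.
Proof.
elim: n p => [|n IH] p /=; first by rewrite JE inE; case: eqP => //= _ ->.
move=> /growP Jp; rewrite mem_cat; apply: contraNT => /norP[np nout].
apply/growP; case: Jp => [Jp|[q [r [Jq qr hr pE]]]].
  by left; apply: contraNT np; apply: IH.
case: (boolP (upto I n q)) => [Iq|Iq]; first by right; exists q, r.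
have [e|[i e]] := adjacent_outer qr; last first.
  case/negP: nout; apply/allpairsP; exists (q, i).
  by rewrite mem_enum IH //= -e.
(* The root cell has no adjacent cell inside the root cube. *)
have q0 : 0 < depth q.
  rewrite lt0n; apply/eqP => q0; case: qr => dr [i [ri _]].
  have [irJ _ _] := good_upto n gJ.
  move/forallP/(_ i): (irJ _ Jq); move/forallP/(_ i): hr.
  by rewrite dr q0 expn0; lia.
left; rewrite pE -anc_parent e; apply: good_anc; first exact: good_upto.
exact: upto_parent.
Qed.

End Insertion.

(** * Brands and maintained states *)

(* The brand of the children of [p]; meaningful for [p] in [upto I d]. *)
Definition brand I p := (\sum_(n < d) ~~ upto I n p).+1.

(** [upto] increases with the round, so the sum counts the rounds before [p] becomes internal. *)
Lemma brandE I n p : n <= d -> upto I n p -> (0 < n -> ~~ upto I n.-1 p) ->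
  brand I p = n.+1.
Proof.
move=> nd In In'; congr S.
rewrite -(big_mkord xpredT (fun m => nat_of_bool (~~ upto I m p))).
rewrite (big_cat_nat (n := n)) //= [X in _ + X]big1_seq ?addn0; last first.
  move=> m; rewrite mem_index_iota => /and3P[_ nm _].
  by rewrite (upto_mono nm In).
rewrite (eq_big_nat _ _ (F2 := fun _ => 1)) ?sum_nat_const_nat; first by lia.
move=> m /andP[_ mn]; rewrite (contra _ (In' _)) //; last by lia.
by apply: upto_mono; lia.
Qed.

(** Siblings appear together, so brands are a function [b] of the parent. Arbitrary [I] and [b] also
    cover the intermediate states of an update. *)
Definition rep (st : state d) I (b : cell d -> nat) :=
  [/\ forall x, st.1 x <-> tree I x, st.2 (root_cell d) = 1
    & forall x, 0 < depth x -> I (parent x) -> st.2 x = b (parent x)].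

Lemma is_extP I st : good I ->
  is_ext (fun x => tree I x) st <-> rep st (upto I d) (brand I).
Proof.
move=> gI; split=> [[cells br]|[cells br0 br]].
  split.
  - by move=> x; rewrite cells /extended (extE d gI).1.
  - by apply: (br 0); rewrite //= /tree eqxx.
  move=> x x0 Ix.
  have ex : exists n, upto I n (parent x) by exists d.
  case: (ex_minnP ex) => n In n_min; have nd := n_min _ Ix.
  have In' : 0 < n -> ~~ upto I n.-1 (parent x).
    by move=> n0; apply/negP => /n_min; lia.
  rewrite (brandE nd In In'); apply: br => //.
  have xp : is_child (parent x) x by apply/is_childE.
  by apply/(extE n gI).2; rewrite !(tree_child _ xp).
split=> [x|n x nd /(extE n gI).2[tx ntx]].
  by rewrite cells /extended (extE d gI).1.
case/orP: tx => [/eqP xr|/andP[x0 Ix]].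
  by case: n nd ntx => [|n] _; rewrite xr // /tree eqxx => /(_ isT).
have xp : is_child (parent x) x by apply/is_childE.
rewrite br //; last exact: upto_mono Ix.
by apply: brandE => // n0; have := ntx n0; rewrite (tree_child _ xp).
Qed.

(** * Sequences of operations and updates of sibling families *)

Lemma reach_leq m n (a b : state d) : m <= n -> reach_within m a b -> reach_within n a b.
Proof.
elim: m n a => [|m IH] [|n] a //= mn; first by left.
by case=> [|[c [ac cb]]]; [left | right; exists c; split=> //; apply: IH cb].
Qed.

Lemma reach_trans m n (a b c : state d) :
  reach_within m a b -> reach_within n b c -> reach_within (m + n) a c.
Proof.
elim: m a => [|m IH] a /=; first by move=> ->.
move=> [->|[a' [aa' a'b]]] bc.
  exact: (reach_leq (leq_addl m.+1 n) bc).
by right; exists a'; split=> //; apply: IH bc.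
Qed.

Lemma recolor (s : seq (cell d)) v (st : state d) : (forall x, x \in s -> st.1 x) ->
  exists st', [/\ reach_within (size s) st st', forall x, st'.1 x <-> st.1 x
    & forall x, st'.2 x = if x \in s then v else st.2 x].
Proof.
elim: s st => [|y s IH] st sP; first by exists st.
pose st1 : state d := (st.1, fun x => if x == y then v else st.2 x).
have [x xs|st' [st1' cells br]] := IH st1; first by apply: sP; rewrite inE xs orbT.
exists st'; split=> // [|x]; last first.
  by rewrite br inE /=; case: (x \in s); rewrite ?orbT ?orbF.
right; exists st1; split=> //; apply: Or33; split=> //.
by exists y; split=> [|x /eqP/negPf/= ->//]; apply: sP; rewrite inE eqxx.
Qed.

(* One brand update per child when [p] stays internal, one split or merge
   otherwise. *)
Lemma update_family I J b b' p st :
  rep st I b -> (forall q, q != p -> J q = I q /\ b' q = b q) ->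
  (forall q, I q || J q -> inroot q /\ (0 < depth q -> I (parent q) && J (parent q))) ->
  exists2 st', reach_within (2 ^ d) st st' & rep st' J b'.
Proof.
move=> [cells br0 br] off cl.
have pow : 0 < 2 ^ d by rewrite expn_gt0.
have [JI|neq] := eqVneq (J p) (I p).
  have IJ q : J q = I q by have [->//|/off[]] := eqVneq q p.
  have treeE x : tree J x = tree I x by rewrite /tree IJ.
  case: (boolP (I p)) => Ip; last first.
    (* With [p] internal on neither side, no present cell takes its brand from [p]. *)
    exists st; first exact: (reach_leq (m := 0)).
    split=> // [x|x x0]; first by rewrite treeE.
    by rewrite IJ => Ix; rewrite br //; have [e|/off[]//] := eqVneq (parent x) p; rewrite -e Ix in Ip.
  have [x /mem_children xp|st' [st_st' cells' br']] := @recolor (children p) (b' p) st.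
    by apply/cells; rewrite (tree_child _ xp).
  exists st'; first by rewrite -(size_children p).
  split=> [x||x x0]; first by rewrite cells' treeE.
    by rewrite br'; case: ifP => // /children_depthP[].
  rewrite IJ br' => Ix; case: ifPn => [/children_depthP[_ ->]//|nx].
  rewrite br //; have [e|/off[]//] := eqVneq (parent x) p.
  by case/negP: nx; apply/mem_children/is_childE.
pose st' : state d :=
  (fun x => is_true (tree J x), fun x => if x \in children p then b' p else st.2 x).
have rep' : rep st' J b'.
  split=> //= [|x x0 Jx]; first by case: ifP => // /children_depthP[].
  case: ifPn => [/children_depthP[_ ->]//|nx].
  have xp : parent x != p by apply: contraNneq nx => e; apply/mem_children/is_childE.
  by have [JI ->] := off _ xp; rewrite br // -JI.
exists st' => //; apply: (reach_leq pow); right; exists st'; split=> //.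
have [ip pp] : inroot p /\ (0 < depth p -> I (parent p) && J (parent p)).
  by apply: cl; case: (I p) (J p) neq => [|] [|].
have [tI tJ] : tree I p /\ tree J p.
  have [p0|p0] := posnP (depth p).
    by rewrite (inroot_depth0 ip p0) /tree eqxx.
  by move: (pp p0); rewrite /tree p0 => /andP[-> ->]; rewrite !orbT.
have same x : ~ is_child p x -> tree J x = tree I x.
  move=> nx; rewrite /tree; have [//|x0] := posnP (depth x).
  by rewrite (off (parent x) _).1 //; apply/eqP => e; apply/nx/is_childE.
have same_brand x : ~ is_child p x -> st'.2 x = st.2 x.
  by move=> nx; rewrite /= ifN //; apply/mem_children.
(* An internal child of [p] would put [p] in both sets, whereas exactly one contains it; so the
   children to be merged are leaves. *)
have no_grandchild x y : is_child p x -> is_child x y -> I x || J x -> False.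
  move=> /is_childE[x0 xp] _ /cl[_ /(_ x0)]; rewrite xp.
  by case: (I p) (J p) neq => [|] [|].
have em (x : cell d) : is_child p x \/ ~ is_child p x by apply: EM.
case Ip: (I p).
  have Jp : J p = false by case: (J p) (neq); rewrite Ip.
  have cellsE x : st'.1 x <-> st.1 x /\ ~ is_child p x.
    rewrite cells /=; have [cx|nx] := em x; last by rewrite same //; tauto.
    by rewrite (tree_child J cx) Jp; split=> // -[].
  apply: Or32; split; last by move=> x /cellsE[_] /same_brand.
  exists p; split=> // [|x px]; first exact/cells.
  split; first by apply/cells; rewrite (tree_child _ px).
  move=> y xy /cells; rewrite (tree_child _ xy) => Ix.
  by apply: no_grandchild px xy _; rewrite Ix.
have Jp : J p by case: (J p) (neq); rewrite Ip.
apply: Or31; split.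
  exists p; split.
    split; first exact/cells.
    by move=> x px /cells; rewrite (tree_child _ px) Ip.
  move=> x; rewrite cells /=; have [cx|nx] := em x; last by rewrite same //; tauto.
  by rewrite (tree_child J cx) Jp; split=> // _; right.
move=> x /cells tx; apply: same_brand => px.
by rewrite (tree_child _ px) Ip in tx.
Qed.

(** The parent of any non-root cell of [I] or [J] lies in both, so the mixed sets met on the way
    stay parent-closed and the families can be treated in list order. *)
Lemma update_families (s : seq (cell d)) I J b b' st :
  rep st I b -> (forall q, q \notin s -> J q = I q /\ b' q = b q) ->
  (forall q, I q || J q -> inroot q /\ (0 < depth q -> I (parent q) && J (parent q))) ->
  exists2 st', reach_within (size s * 2 ^ d) st st' & rep st' J b'.
Proof.
elim: s I b st => [|p s IH] I b st rst off cl.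
  exists st; first by [].
  case: rst => cells br0 br; split=> // [x|x x0].
    by rewrite cells /tree (off _ _).1.
  by have [-> ->] := off (parent x) isT; apply: br.
pose I1 q := if q == p then J q else I q.
pose b1 q := if q == p then b' q else b q.
have I1_or q : I1 q -> I q || J q by rewrite /I1; case: ifP => _ ->; rewrite ?orbT.
have I1_and q : I q && J q -> I1 q by rewrite /I1; case: ifP => _ /andP[].
have [|q|st1 st_st1 rep1] := @update_family I I1 b b1 p st rst.
- by move=> q /negPf qp; rewrite /I1 /b1 qp.
- move=> Iq; have [irq cq] : inroot q /\ (0 < depth q -> I (parent q) && J (parent q)).
    by apply: cl; case/orP: Iq => [->//|/I1_or].
  by split=> // /cq pq; rewrite I1_and //; case/andP: pq => ->.
have [q qs|q|st2 st1_st2 rep2] := IH I1 b1 st1 rep1.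
- rewrite /I1 /b1; case: eqP => // /eqP qp; apply: off.
  by rewrite inE (negPf qp).
- move=> Iq; have [irq cq] : inroot q /\ (0 < depth q -> I (parent q) && J (parent q)).
    by apply: cl; case/orP: Iq => [/I1_or//|->]; rewrite orbT.
  by split=> // /cq pq; rewrite I1_and //; case/andP: pq => _ ->.
by exists st2 => //; rewrite mulSn; apply: reach_trans st1_st2.
Qed.

(** * Cost of one insertion or removal *)

Section Update.
Variables (I J : pred (cell d)) (c0 : cell d).
Hypotheses (gI : good I) (gJ : good J) (JE : forall p, J p = (p == c0) || I p).
Hypothesis (tc0 : tree I c0).

Lemma not_reached q : q \notin reached c0 d ->
  upto J d q = upto I d q /\ brand J q = brand I q.
Proof.
move=> nq; have same n : n <= d -> upto J n q = upto I n q.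
  move=> nd; apply/idP/idP => [Jq|]; last exact: upto_sub.
  apply: contraNT nq => nIq; apply: (reached_mono nd).
  exact: upto_reached Jq nIq.
split; first exact: same.
by congr S; apply: eq_bigr => n _; rewrite same // ltnW.
Qed.

Lemma upto_parents q : upto I d q || upto J d q ->
  inroot q /\ (0 < depth q -> upto I d (parent q) && upto J d (parent q)).
Proof.
have [irJ _ _] := good_upto d gJ.
move=> Hq; have {Hq}Jq : upto J d q by case/orP: Hq => // /(upto_sub JE).
split=> [|q0]; first exact: irJ.
by have Iq := upto_parent gI JE tc0 Jq q0; rewrite Iq (upto_sub JE).
Qed.

Lemma update_cost (d0 : 0 < d) : size (reached c0 d) * 2 ^ d <= 8 * (2 * d) ^ d.
Proof.
rewrite size_reached expnMn mulnCA mulnC leq_mul2l.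
by rewrite expS_le_expn // orbT.
Qed.

Lemma insert_update (d0 : 0 < d) st : is_ext (fun x => tree I x) st ->
  exists st', is_ext (fun x => tree J x) st' /\ reach_within (8 * (2 * d) ^ d) st st'.
Proof.
move=> /(is_extP _ gI) rst.
have [st' r rst'] := update_families rst not_reached upto_parents.
exists st'; split; first exact/is_extP.
exact: reach_leq (update_cost d0) r.
Qed.

(** The conditions that [update_families] puts on the two sets are symmetric, so the list of
    families for the insertion also serves backwards. *)
Lemma remove_update (d0 : 0 < d) st : is_ext (fun x => tree J x) st ->
  exists st', is_ext (fun x => tree I x) st' /\ reach_within (8 * (2 * d) ^ d) st st'.
Proof.
move=> /(is_extP _ gJ) rst.
have [q /not_reached[-> ->]//|q|st' r rst'] :=
  @update_families (reached c0 d) (upto J d) (upto I d) (brand J) (brand I) st rst.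
  by rewrite orbC andbC; apply: upto_parents.
exists st'; split; first exact/is_extP.
exact: reach_leq (update_cost d0) r.
Qed.

End Update.

(** * Splits and merges as changes of one internal cell *)

Lemma good_insert I c : good I -> tree I c -> good (predU1 c I).
Proof.
move=> gI tc; have [ir cl [K bK]] := gI; split.
- by move=> p /predU1P[->|/ir//]; apply: tree_inroot tc.
- move=> p /predU1P[->|Ip]; apply/predU1P; last by right; apply: cl.
  case/orP: tc => [/eqP->|/andP[_]]; last by right.
  by left; apply: (@anc_root 1) => //; apply: inroot_root.
exists (maxn K (depth c)) => p /predU1P[->|/bK]; first exact: leq_maxr.
by move=> pK; rewrite (leq_trans pK) ?leq_maxl.
Qed.

End Cells.

Theorem theorem22 :
  exists C : nat,
    forall (d : nat), 0 < d ->
    forall (T1 T1' : cset d),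
      quadtree T1 ->
      (split_op T1 T1' \/ merge_op T1 T1') ->
      forall st : state d, is_ext T1 st ->
        exists st' : state d,
          is_ext T1' st' /\ reach_within (C * (2 * d) ^ d) st st'.
Proof.
exists 8 => d d0 T1 T1' /quadtreeP[I gI ->] op st.
case: op => [[c [/leaf_tree[tc nc] T1E]]|[c [tc leaves T1E]]].
  have gJ := good_insert gI tc.
  have -> : T1' = (fun x => tree (predU1 c I) x).
    apply/predeqP => x; rewrite T1E is_childE /tree /=.
    case: eqVneq => _ /=; first by split=> // _; left.
    split=> [[/andP[-> ->]|[-> ->]]|/andP[x0 /predU1P[xc|Ix]]].
    - by rewrite orbT.
    - by rewrite eqxx.
    - by right.
    by left; rewrite x0.
  exact: (@insert_update _ I _ c).
(* A merge undoes the insertion of [c]; since the children of [c] are leaves, the remaining set is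
   parent-closed. *)
pose J p := (p != c) && I p.
have Ic : I c.
  have cc := child_is_child c [ffun => false].
  by have [] := leaves _ cc; rewrite (tree_child I cc).
have gJ : good J.
  have [ir cl [K bK]] := gI; split.
  - by move=> p /andP[_ /ir].
  - move=> p /andP[pc Ip]; rewrite /J cl // andbT; apply/eqP => e.
    have [p0|p0] := posnP (depth p).
      case/eqP: pc; rewrite -e (inroot_depth0 (ir _ Ip) p0).
      by apply/esym/(@anc_root _ 1); rewrite ?inroot_root.
    have cp : is_child c p by apply/is_childE.
    by have /leaf_tree[_] := leaves _ cp; rewrite Ip.
  by exists K => p /andP[_ /bK].
have tJc : tree J c.
  move: tc => /orP[/eqP->|/andP[c00 Ip]]; first by rewrite /tree eqxx.
  rewrite /tree /J c00 Ip andbT /= orbC; apply/orP; left; apply/eqP => e.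
  by have := congr1 (@depth d) e; rewrite depth_parent; lia.
have -> : T1' = (fun x => tree J x).
  apply/predeqP => x; rewrite T1E is_childE /tree /J.
  case: eqVneq => [->|_] /=; first by split=> // _; split=> // -[].
  split=> [[/andP[-> ->] h]|/and3P[x0 /eqP xc Ix]].
    by rewrite andbT; apply/eqP => e; apply: h.
  by split; [rewrite x0 | case].
apply: (@remove_update _ J I c) => // p.
by rewrite /J; case: eqVneq => [->|].
Qed.
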